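(* The Improving Direction Method ($IDM$) is not Strategy-Proof: there exist $k\ge 0$, parameters $\beta_1,\beta_2\ge 0$, a starting point $x_0\in D^\circ$ and a declared utility $v\in\mathcal{U}$ such that, with true utilities $u_1(x)=\log x_1+\beta_1\log(k-x_1-x_2)$ and $u_2(x)=\log x_2+\beta_2\log(k-x_1-x_2)$, the settlements $IDM(u_1,u_2,x_0)$ and $IDM(v,u_2,x_0)$ are both defined and $$u_1\big(IDM(v,u_2,x_0)\big) > u_1\big(IDM(u_1,u_2,x_0)\big).$$
   Context: Two parties $P_1,P_2$ negotiate over a point of the triangular domain $D=\{(x_1,x_2)\in\mathbb{R}^2 : x_1,x_2\ge 0,\ x_1+x_2\le k\}$, with interior $D^\circ$. The class of utility functions is $$\mathcal{U}=\{\alpha_1\log x_1+\alpha_2\log x_2+\alpha_3\log(k-x_1-x_2) : \alpha_1,\alpha_2,\alpha_3\ge 0\},$$ with the conventions $\log 0=-\infty$ and $0\cdot(-\infty)=0$; these functions are real-valued and differentiable on $D^\circ$. The true utility of $P_1$ has parameters $(1,0,\beta_1)$ and that of $P_2$ has parameters $(0,1,\beta_2)$. The Improving Direction Method ($IDM$). Given declared utilities $w_1,w_2$ and a current settlement $x_t\in D^\circ$ at which both gradients are nonzero, the mediator announces the bisecting direction $$d_t=\frac{\nabla w_1(x_t)}{2\|\nabla w_1(x_t)\|}+\frac{\nabla w_2(x_t)}{2\|\nabla w_2(x_t)\|}.$$ Each party $i$ declares the maximum movement it wants to make in this direction, $$\lambda_i=\sup\{\lambda\ge 0 : x_t+sd_t\in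 D \text{ for all } s\in[0,\lambda], \text{ and } s\mapsto w_i(x_t+sd_t) \text{ is strictly increasing on } [0,\lambda]\}.$$ (When $w_i$ is strictly concave along the ray, this is the distance to the maximizer of $w_i$ on the part of the ray lying in $D$.) The new settlement is $x_{t+1}=x_t+\lambda_t^*d_t$ with $\lambda_t^*=\min(\lambda_1,\lambda_2)$. The final settlement $IDM(w_1,w_2,x_0)$ is the limit of the sequence $(x_t)_{t\ge 0}$ started at $x_0$. It is defined if all the iterates are defined and the sequence converges. A negotiation method is Strategy-Proof if negotiating with the real utility function gains a party the best ending settlement (as measured by its real utility), regardless of the utility profile of the other party. *)

(* Defs.v *)
From mathcomp Require Import all_boot all_order all_algebra.
From mathcomp Require Import all_classical all_reals all_analysis.

Set Implicit Arguments.
Unset Strict Implicit.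
Unset Printing Implicit Defensive.

Import Order.TTheory GRing.Theory Num.Theory.
Import numFieldNormedType.Exports.

Local Open Scope classical_set_scope.
Local Open Scope ring_scope.

Section Defs.
Variable R : realType.
Implicit Types (k : R) (w : 'rV[R]_2 -> \bar R) (x d : 'rV[R]_2).

Definition dom k : set 'rV[R]_2 :=
  [set x | 0 <= x 0 0 /\ 0 <= x 0 1 /\ x 0 0 + x 0 1 <= k].

(* Extended-real valued: [lne 0 = -oo] and [0 * -oo = 0] in [\bar R]. *)
Definition utility k (a1 a2 a3 : R) x : \bar R :=
  (a1%:E * lne (x 0 0)%:E + a2%:E * lne (x 0 1)%:E
   + a3%:E * lne (k - x 0 0 - x 0 1)%:E)%E.

Definition utility_class k : set ('rV[R]_2 -> \bar R) :=
  [set w | exists a1 a2 a3 : R,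
     [/\ 0 <= a1, 0 <= a2, 0 <= a3 & w = utility k a1 a2 a3]].

(* The norm [`|x|] of MathComp-Analysis on row vectors is the sup norm, hence
   this Euclidean norm. *)
Definition euclidean_norm x : R := Num.sqrt (\sum_i x 0 i ^+ 2).

(* [fine] loses nothing: the gradient is only used at interior points of the
   domain, near which the utilities are finite. *)
Definition gradient w x : 'rV[R]_2 :=
  \row_i 'D_(delta_mx 0 i) (fine \o w) x.

Definition bisecting_direction w1 w2 x : 'rV[R]_2 :=
  (2 * euclidean_norm (gradient w1 x))^-1 *: gradient w1 x
  + (2 * euclidean_norm (gradient w2 x))^-1 *: gradient w2 x.

(* For [x] in the domain, the set contains 0 and is bounded above (it is [{0}]
   if [d = 0]; otherwise use that the domain is bounded), so [sup] is not a
   default value. *)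
Definition max_move k w x d : R :=
  sup [set l : R | [/\ 0 <= l,
         forall s, s \in `[0, l] -> dom k (x + s *: d)
       & {in `[0, l] &, {homo (fun s => w (x + s *: d)) : s t / (s < t)%R
                                                           >-> (s < t)%E}}]].

Definition idm_step k w1 w2 x : 'rV[R]_2 :=
  let d := bisecting_direction w1 w2 x in
  x + Num.min (max_move k w1 x d) (max_move k w2 x d) *: d.

Definition idm_seq k w1 w2 x0 (t : nat) : 'rV[R]_2 :=
  iter t (idm_step k w1 w2) x0.

Definition idm_defined k w1 w2 x0 : Prop :=
  (forall t, let x := idm_seq k w1 w2 x0 t in
     [/\ (dom k)° x, gradient w1 x != 0 & gradient w2 x != 0])
  /\ cvgn (idm_seq k w1 w2 x0).

(* A method maps [k], the two declared utilities and the starting point to the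
   final settlement, [None] meaning that there is none. *)
Definition negotiation_method : Type :=
  R -> ('rV[R]_2 -> \bar R) -> ('rV[R]_2 -> \bar R) -> 'rV[R]_2 ->
  option 'rV[R]_2.

Definition IDM : negotiation_method := fun k w1 w2 x0 =>
  if `[< idm_defined k w1 w2 x0 >] then Some (limn (idm_seq k w1 w2 x0))
  else None.

(* Outcomes are compared whenever both settlements exist. *)
Definition strategy_proof (M : negotiation_method) : Prop :=
  forall (k b1 b2 : R) (x0 : 'rV[R]_2) (v : 'rV[R]_2 -> \bar R),
  0 <= k -> 0 <= b1 -> 0 <= b2 -> (dom k)° x0 -> utility_class k v ->
  let u1 := utility k 1 0 b1 in
  let u2 := utility k 0 1 b2 in
  forall y z : 'rV[R]_2, M k u1 u2 x0 = Some y ->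
  (M k v u2 x0 = Some z -> (u1 z <= u1 y)%E) /\
  (M k u1 v x0 = Some z -> (u2 z <= u2 y)%E).

End Defs.
Arguments IDM {R}.

(* Main.v *)
(** Take k = 60, beta1 = beta2 = 1 and start at (24, 24).  If the ray along the
    announced direction meets a point where both declared utilities are
    stationary along the ray, both parties stop there; their gradients are then
    orthogonal to the direction, hence parallel, and if they are opposite the
    announced direction is 0 and the process stays there.  Truthful play is
    symmetric, so it stops after one step at (15, 15).  Declaring
    (8/3, 1/15, 17/15) turns the direction into (-1, -2), along which both
    declared utilities peak at (20, 16), and there x1 (k - x1 - x2) is 480
    instead of 450.  This declaration was found by solving the linear system
    expressing that its gradient at (24, 24) is the mirror image of that of u2
    in the line spanned by (-1, -2), and that it is stationary along this line
    at the maximizer (20, 16) of u2. *)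
Require Import Defs.
From mathcomp Require Import all_boot all_order all_algebra.
From mathcomp Require Import all_classical all_reals all_analysis.
From mathcomp Require Import ring lra.
Import Order.TTheory GRing.Theory Num.Theory.
Import numFieldNormedType.Exports.
Local Open Scope classical_set_scope.
Local Open Scope ring_scope.

Section ImprovingDirection.
Context {R : realType}.
Implicit Types (k a b c : R) (x y d g : 'rV[R]_2).

(** * Points of the plane in coordinates *)

Definition pt (u v : R) : 'rV[R]_2 := \row_i (if i == 0 then u else v).

Lemma pt0E u v : pt u v 0 0 = u.
Proof. by rewrite mxE. Qed.

Lemma pt1E u v : pt u v 0 1 = v.
Proof. by rewrite mxE. Qed.

Definition ptE := (pt0E, pt1E).

Lemma pt_neq0 (p q : R) : 0 < `|p| -> pt p q != 0.
Proof.
by rewrite normr_gt0; apply: contra => /eqP/rowP/(_ 0); rewrite ptE mxE => ->.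
Qed.

Lemma pt_eta x : x = pt (x 0 0) (x 0 1).
Proof.
apply/rowP => i; rewrite mxE; case: eqVneq => [-> //|i0].
by congr (x _ _); apply/val_inj; case: i i0 => -[|[|]].
Qed.

Lemma addpt u v u' v' : pt u v + pt u' v' = pt (u + u') (v + v').
Proof. by rewrite [LHS]pt_eta !mxE. Qed.

Lemma scalept r u v : r *: pt u v = pt (r * u) (r * v).
Proof. by rewrite [LHS]pt_eta !mxE. Qed.

(** * The open triangle and the gradient of a utility on it *)

Definition open_dom k : set 'rV[R]_2 :=
  [set x | [/\ 0 < x 0 0, 0 < x 0 1 & 0 < k - x 0 0 - x 0 1]].

Lemma open_dom_nbhs k x : open_dom k x -> \forall y \near x, open_dom k y.
Proof.
move=> [x0 x1 xk].
have C0 : (fun y : 'rV[R]_2 => y 0 0) @ x --> x 0 0 by exact: coord_continuous.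
have C1 : (fun y : 'rV[R]_2 => y 0 1) @ x --> x 0 1 by exact: coord_continuous.
have C2 : (fun y : 'rV[R]_2 => k - y 0 0 - y 0 1) @ x --> k - x 0 0 - x 0 1.
  by apply: cvgB C1; apply: cvgB C0; exact: cvg_cst.
near=> y; split; near: y.
- exact: cvgr_gt _ C0 _ x0.
- exact: cvgr_gt _ C1 _ x1.
- exact: cvgr_gt _ C2 _ xk.
Unshelve. all: by end_near. Qed.

Lemma open_dom_sub k x : open_dom k x -> dom k x.
Proof. by move=> [x0 x1 xk]; split; last split; lra. Qed.

Lemma open_dom_interior k x : open_dom k x -> (dom k)° x.
Proof. by move=> /open_dom_nbhs; apply: filterS => y; exact: open_dom_sub. Qed.

Lemma utility_fin k a b c x : open_dom k x ->
  utility k a b c x =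
  (a * ln (x 0 0) + b * ln (x 0 1) + c * ln (k - x 0 0 - x 0 1))%:E.
Proof. by move=> [x0 x1 xk]; rewrite /utility !lne_EFin// -!EFinM. Qed.

(** All three logarithms are finite near [x], so [fine] can be replaced there by the real formula
    [F] without changing the derivatives. *)
Lemma gradient_utility k a b c x : open_dom k x ->
  gradient (utility k a b c) x =
  pt (a / x 0 0 - c / (k - x 0 0 - x 0 1))
     (b / x 0 1 - c / (k - x 0 0 - x 0 1)).
Proof.
move=> Dx; have [x0 x1 xk] := Dx.
have DuE d : 'D_d (fine \o utility k a b c) x =
    a * d 0 0 / x 0 0 + b * d 0 1 / x 0 1
    - c * (d 0 0 + d 0 1) / (k - x 0 0 - x 0 1).
  pose F y := a * ln (y 0 0) + b * ln (y 0 1) + c * ln (k - y 0 0 - y 0 1).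
  have -> : 'D_d (fine \o utility k a b c) x = 'D_d F x.
    apply: near_eq_derive; near=> y; rewrite /= utility_fin//; near: y.
    exact: open_dom_nbhs.
  pose G (h : R) := F (h *: d + x).
  (* Restricting [F] to the line through [x] along [d] leaves a sum of logarithms of affine
     functions of one variable. *)
  have -> : 'D_d F x = 'D_1 G 0.
    rewrite /derive.
    suff -> : (fun h : R => h^-1 *: ((F \o shift x) (h *: d) - F x)) =
        (fun h => h^-1 *: ((G \o shift 0) (h *: (1 : R)) - G 0)) by [].
    apply/funext => h /=; rewrite /G -![GRing.scale _ (1 : R)]/(_ * _).
    by rewrite mulr1 addr0 scale0r add0r.
  have L (A D : R) : 0 < A ->
      is_derive (0 : R) (1 : R) (fun h => ln (h * D + A)) (D / A).
    move=> A0.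
    have dl : is_derive (0 : R) (1 : R) (fun h : R => h * D + A) D.
      by apply: is_derive_eq; rewrite !scaler0 add0r addr0; exact: mulr1.
    have dln : is_derive (0 * D + A) (1 : R) (@ln R) A^-1.
      by rewrite mul0r add0r; exact: is_derive1_ln.
    rewrite mulrC.
    exact: (@is_derive1_comp _ (@ln R) (fun h : R => h * D + A) 0 _ _ dln dl).
  have E : G = (a *: (fun h : R => ln (h * d 0 0 + x 0 0)))
      + (b *: (fun h : R => ln (h * d 0 1 + x 0 1)))
      + (c *: (fun h : R => ln (h * - (d 0 0 + d 0 1) + (k - x 0 0 - x 0 1)))).
    apply/funext => h; rewrite /G /F !fctE /= !mxE.
    by congr (_ * _ + _ * _ + _ * ln _); ring.
  have := L _ (d 0 0) x0; have := L _ (d 0 1) x1.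
  have := L _ (- (d 0 0 + d 0 1)) xk => d2 d1 d0.
  rewrite E (@derive_val _ _ _ _ _ _ _
    (is_deriveD (is_deriveD (is_deriveZ a d0) (is_deriveZ b d1))
                (is_deriveZ c d2))).
  by rewrite -![GRing.scale _ (_ / _ : R)]/(_ * _); ring.
rewrite [LHS]pt_eta !mxE !DuE !mxE /=; congr pt; ring.
Unshelve. all: by end_near. Qed.

(** * Tangent and chord bounds for the logarithm *)

Lemma ln_lt_tangent (p q : R) : 0 < p -> 0 < q -> p != q ->
  ln p < ln q + (p - q) / q.
Proof.
move=> p0 q0 pq.
have pq0 : 0 < p / q by rewrite divr_gt0.
(* The strict bound [1 + u < expR u] holds for [u != 0]; it is applied to [u = ln (p / q)]. *)
have : ln (p / q) != 0.
  rewrite ln_eq0//; apply: contra pq => /eqP pq1.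
  by rewrite -[p](divfK (lt0r_neq0 q0)) pq1 mul1r.
move=> /expR_gt1Dx; rewrite lnK// ln_div// mulrBl divff ?gt_eqF//; lra.
Qed.

(** The case [p <= 0], where the left side is -oo, covers movements that end on the boundary of the
    triangle. *)
Lemma lne_le_tangent (p q : R) : 0 < q ->
  (lne p%:E <= (ln q + (p - q) / q)%:E)%E.
Proof.
move=> q0; case: (leP p 0) => p0; first by rewrite le0_lneNy ?leNye.
rewrite lne_EFin// lee_fin; case: (eqVneq p q) => [->|pq].
  by rewrite subrr mul0r addr0.
exact/ltW/ln_lt_tangent.
Qed.

(** By concavity the slope along the ray decreases, so up to [t] it is at least its value at [l].
    Slopes are taken at [l] because stationarity makes their weighted sum vanish there. *)
Lemma ln_chord_gt (A D s t l : R) : s < t -> t <= l -> 0 < A + s * D ->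
  0 < A + t * D -> 0 < A + l * D -> D != 0 ->
  ln (A + s * D) + (t - s) * (D / (A + l * D)) < ln (A + t * D).
Proof.
move=> st tl P0 Q0 M0 D0.
have /ln_lt_tangent : A + s * D != A + t * D.
  rewrite -subr_eq0 opprD addrACA subrr add0r -mulrBl.
  by rewrite mulf_neq0// subr_eq0 lt_eqF.
move=> /(_ P0 Q0).
suff : (t - s) * (D / (A + l * D)) <= (t - s) * (D / (A + t * D)).
  have -> : (A + s * D - (A + t * D)) / (A + t * D)
    = - ((t - s) * (D / (A + t * D))) by ring.
  lra.
rewrite ler_pM2l ?subr_gt0// -subr_ge0.
have -> : D / (A + t * D) - D / (A + l * D)
   = (l - t) * D ^+ 2 / ((A + t * D) * (A + l * D)).
  by field; rewrite !gt_eqF.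
apply: divr_ge0; apply: mulr_ge0; rewrite ?sqr_ge0 ?subr_ge0//; exact: ltW.
Qed.

Lemma ln_chord_ge (A D s t l : R) : s < t -> t <= l -> 0 < A + s * D ->
  0 < A + t * D -> 0 < A + l * D ->
  ln (A + s * D) + (t - s) * (D / (A + l * D)) <= ln (A + t * D).
Proof.
move=> st tl P0 Q0 M0; case: (eqVneq D 0) => [->|D0].
  by rewrite !mulr0 mul0r mulr0 !addr0.
exact/ltW/ln_chord_gt.
Qed.
Arguments ln_chord_gt {A D s t l}.
Arguments ln_chord_ge {A D s t l}.

(** * Maximal movement along a ray *)

Lemma open_dom_segment k x d (l s : R) : open_dom k x ->
  open_dom k (x + l *: d) -> 0 <= s <= l -> open_dom k (x + s *: d).
Proof.
have pos (A D : R) : 0 < A -> 0 < A + l * D -> 0 <= s <= l -> 0 < A + s * D.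
  by move=> A0 Al /andP[s0 sl]; case: (leP 0 D) => D0; nra.
move=> [x0 x1 xk] []; rewrite !mxE => y0 y1 yk sl; split; rewrite !mxE.
- exact: pos.
- exact: pos.
- have := pos (k - x 0 0 - x 0 1) (- (d 0 0 + d 0 1)) xk.
  by move=> /(_ _ sl); lra.
Qed.

(* A concave function increases up to a stationary point and not beyond. *)
Lemma max_move_stationary k a b c x d (l : R) :
  0 <= a -> 0 <= b -> 0 <= c -> 0 <= l ->
  open_dom k x -> open_dom k (x + l *: d) ->
  0 < a * `|d 0 0| + b * `|d 0 1| ->
  (let g := gradient (utility k a b c) (x + l *: d) in
   g 0 0 * d 0 0 + g 0 1 * d 0 1 = 0) ->
  max_move k (utility k a b c) x d = l.
Proof.
move=> a0 b0 c0 l0 Dx Dl nz /=; rewrite gradient_utility// !ptE => grad0.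
have Ds (s : R) : 0 <= s <= l -> open_dom k (x + s *: d).
  exact: open_dom_segment.
have slackE s : k - (x + s *: d) 0 0 - (x + s *: d) 0 1 =
    k - x 0 0 - x 0 1 + s * - (d 0 0 + d 0 1) by rewrite !mxE; ring.
have [M0 M1 M2] := Dl.
move: M0 M1 M2 grad0; rewrite !slackE !mxE => M0 M1 M2 grad0.
rewrite /max_move; set S := (X in sup X).
(* In the sum of the three weighted chord bounds the slopes at [l] cancel. Strictness comes from a
   coordinate with positive weight that moves along [d], provided by [nz]. *)
have incr (s t : R) : 0 <= s <= l -> 0 <= t <= l -> s < t ->
    (utility k a b c (x + s *: d) < utility k a b c (x + t *: d))%E.
  move=> sl tl st; rewrite !utility_fin ?lte_fin; [|exact: Ds..].
  have [P0 P1 P2] := Ds _ sl; have [Q0 Q1 Q2] := Ds _ tl.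
  move: P0 P1 P2 Q0 Q1 Q2; rewrite !slackE !mxE => P0 P1 P2 Q0 Q1 Q2.
  have tl' : t <= l by case/andP: tl.
  have E0 := ler_wpM2l a0 (ln_chord_ge st tl' P0 Q0 M0).
  have E1 := ler_wpM2l b0 (ln_chord_ge st tl' P1 Q1 M1).
  have E2 := ler_wpM2l c0 (ln_chord_ge st tl' P2 Q2 M2).
  move: grad0 => /(congr1 ( *%R (t - s))); rewrite mulr0 => grad0.
  case: (eqVneq (a * `|d 0 0|) 0) => [ad0|].
    move: nz; rewrite ad0 add0r => /lt0r_neq0.
    rewrite mulf_eq0 negb_or normr_eq0 => /andP[bn0 dn0].
    have p0 : 0 < b by rewrite lt0r bn0.
    have lt := ln_chord_gt st tl' P1 Q1 M1 dn0.
    by have := mulr_gt0 p0 (etrans (subr_gt0 _ _) lt); lra.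
  rewrite mulf_eq0 negb_or normr_eq0 => /andP[an0 dn0].
  have p0 : 0 < a by rewrite lt0r an0.
  have lt := ln_chord_gt st tl' P0 Q0 M0 dn0.
  by have := mulr_gt0 p0 (etrans (subr_gt0 _ _) lt); lra.
have Sl : S l.
  by split => // s; rewrite in_itv/= => /Ds/open_dom_sub.
(* Past [l], the tangents at [l] bound the utility by its value at [l], again because their weighted
   slopes sum to 0. The point at [m] may be on the boundary, so the bound is taken in the extended
   reals. *)
have ubS : ubound S l.
  move=> m [m0 _ incrm]; rewrite leNgt; apply/negP => lm.
  have := incrm l m; rewrite !in_itv/= l0 lexx m0 ltW// => /(_ isT isT lm).
  apply/negP; rewrite -leNgt (utility_fin _ _ _ _ _ Dl) /utility !slackE !mxE.
  have T A D : 0 < A + l * D ->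
      (lne (A + m * D)%:E <= (ln (A + l * D) + (m - l) * D / (A + l * D))%:E)%E.
    move=> /(lne_le_tangent (A + m * D)).
    by have -> : A + m * D - (A + l * D) = (m - l) * D by ring.
  apply: (@le_trans _ _
    (a%:E * (ln (x 0 0 + l * d 0 0) + (m - l) * d 0 0 / (x 0 0 + l * d 0 0))%:E
    + b%:E * (ln (x 0 1 + l * d 0 1) + (m - l) * d 0 1 / (x 0 1 + l * d 0 1))%:E
    + c%:E * (ln (k - x 0 0 - x 0 1 + l * - (d 0 0 + d 0 1))
         + (m - l) * - (d 0 0 + d 0 1)
            / (k - x 0 0 - x 0 1 + l * - (d 0 0 + d 0 1)))%:E)%E).
    by apply: leeD; [apply: leeD|]; apply: lee_wpmul2l; rewrite ?lee_fin//;
      exact: T.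
  move: grad0 => /(congr1 ( *%R (m - l))); rewrite mulr0 => grad0.
  rewrite -!EFinM -!EFinD lee_fin; lra.
apply/eqP; rewrite eq_le ge_sup//; last by exists l.
by rewrite ub_le_sup//; exists l.
Qed.

(** * Euclidean norms, announced directions and steps of the process *)

Lemma euclidean_norm_pt u v :
  euclidean_norm (pt u v) = Num.sqrt (u ^+ 2 + v ^+ 2).
Proof.
by rewrite /euclidean_norm big_ord_recl big_ord1 !mxE.
Qed.

Lemma euclidean_normZ r x : 0 <= r ->
  euclidean_norm (r *: x) = r * euclidean_norm x.
Proof.
move=> r0; rewrite (pt_eta x) scalept !euclidean_norm_pt.
by rewrite !exprMn -mulrDr sqrtrM ?sqr_ge0// sqrtr_sqr ger0_norm.
Qed.

Lemma euclidean_normN x : euclidean_norm (- x) = euclidean_norm x.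
Proof. by congr Num.sqrt; apply: eq_bigr => i _; rewrite mxE sqrrN. Qed.

Lemma euclidean_norm_gt0 x : 0 < `|x 0 0| -> 0 < euclidean_norm x.
Proof.
rewrite normr_gt0 => x0; rewrite (pt_eta x) euclidean_norm_pt sqrtr_gt0.
by rewrite ltr_pwDl ?sqr_ge0// exprn_even_gt0.
Qed.

(** Equal norms give both gradients the same normalizing factor, so the direction is parallel to
    their plain sum. The abstract [r] keeps square roots out of later computations. *)
Lemma bisecting_direction_eq_norm w1 w2 x e (t : R) : 0 < t ->
  0 < `|gradient w1 x 0 0| ->
  euclidean_norm (gradient w2 x) = euclidean_norm (gradient w1 x) ->
  gradient w1 x + gradient w2 x = t *: e ->
  exists2 r : R, 0 < r & bisecting_direction w1 w2 x = r *: e.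
Proof.
move=> t0 g0 eqn sumE; exists ((2 * euclidean_norm (gradient w1 x))^-1 * t).
  by rewrite mulr_gt0// invr_gt0 mulr_gt0// euclidean_norm_gt0.
by rewrite /bisecting_direction eqn -scalerDr sumE scalerA.
Qed.

(** The two normalized gradients cancel, so the direction is 0 whatever movements are declared. *)
Lemma idm_step_opposed k w1 w2 x r : 0 < r ->
  gradient w2 x = (- r) *: gradient w1 x -> idm_step k w1 w2 x = x.
Proof.
move=> r0 g2; rewrite /idm_step; set d := bisecting_direction _ _ _.
have -> : d = 0.
  rewrite /d /bisecting_direction g2 scaleNr euclidean_normN.
  rewrite euclidean_normZ ?ltW//.
  rewrite scalerN scalerA mulrCA [(r * _)^-1]invfM mulrAC mulVf ?gt_eqF// mul1r.
  exact: subrr.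
by rewrite scaler0 addr0.
Qed.

(** Both declared movements equal [s / r], the parameter of [y] along the announced direction
    [r *: d]. *)
Lemma idm_step_common_maximum k a1 b1 c1 a2 b2 c2 x d (r s : R) :
  let w1 := utility k a1 b1 c1 in let w2 := utility k a2 b2 c2 in
  let y := x + s *: d in
  0 <= a1 -> 0 <= b1 -> 0 <= c1 -> 0 <= a2 -> 0 <= b2 -> 0 <= c2 ->
  0 < r -> bisecting_direction w1 w2 x = r *: d ->
  0 <= s -> open_dom k x -> open_dom k y ->
  0 < a1 * `|d 0 0| + b1 * `|d 0 1| ->
  0 < a2 * `|d 0 0| + b2 * `|d 0 1| ->
  gradient w1 y 0 0 * d 0 0 + gradient w1 y 0 1 * d 0 1 = 0 ->
  gradient w2 y 0 0 * d 0 0 + gradient w2 y 0 1 * d 0 1 = 0 ->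
  idm_step k w1 w2 x = y.
Proof.
move=> w1 w2 y a10 b10 c10 a20 b20 c20 r0 dE s0 Dx Dy nz1 nz2 g1 g2.
have yE : x + (s / r) *: (r *: d) = y by rewrite scalerA divfK ?gt_eqF.
have M a b c : 0 <= a -> 0 <= b -> 0 <= c ->
    0 < a * `|d 0 0| + b * `|d 0 1| ->
    (let g := gradient (utility k a b c) y in
     g 0 0 * d 0 0 + g 0 1 * d 0 1 = 0) ->
    max_move k (utility k a b c) x (r *: d) = s / r.
  move=> a0 b0 c0 nz g; apply: max_move_stationary; rewrite ?yE//.
  - by rewrite divr_ge0// ltW.
  - rewrite !mxE !normrM (gtr0_norm r0) 2!(mulrCA _ r) -mulrDr.
    exact: mulr_gt0.
  - have dE' j : (r *: d) 0 j = r * d 0 j by rewrite mxE.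
    by rewrite /= !dE' 2!(mulrCA _ r) -mulrDr g mulr0.
by rewrite /idm_step dE !M// minxx yE.
Qed.

(** The sequence is constant from index 1 on, so it converges, and definedness has to be checked at
    [x] and [y] only. *)
Lemma IDM_one_step k w1 w2 x y :
  open_dom k x -> open_dom k y ->
  gradient w1 x != 0 -> gradient w2 x != 0 ->
  gradient w1 y != 0 -> gradient w2 y != 0 ->
  idm_step k w1 w2 x = y -> idm_step k w1 w2 y = y ->
  IDM k w1 w2 x = Some y.
Proof.
move=> Dx Dy g1x g2x g1y g2y xy yy.
have seqS t : idm_seq k w1 w2 x t.+1 = y.
  elim: t => [|t IHt]; first exact: xy.
  by rewrite -[RHS]yy -[in RHS]IHt.
have seq_cvg : idm_seq k w1 w2 x @ \oo --> y.
  rewrite -cvg_shiftS (_ : [sequence _]_n = cst y); first exact: cvg_cst.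
  exact/funext.
rewrite /IDM; case: asboolP => [_|]; first by congr Some; exact: cvg_lim.
case; split; last by apply/cvg_ex; exists y.
case=> [|t]; first by split=> //; exact: open_dom_interior.
by rewrite seqS; split=> //; exact: open_dom_interior.
Qed.

End ImprovingDirection.

(** * The truthful and the manipulated negotiation *)

Theorem theorem1 (R : realType) :
  ~ strategy_proof (@IDM R) /\
  exists (k b1 b2 : R) (x0 : 'rV[R]_2) (v : 'rV[R]_2 -> \bar R),
    let u1 := utility k 1 0 b1 in
    let u2 := utility k 0 1 b2 in
    [/\ 0 <= k, 0 <= b1 /\ 0 <= b2, (dom k)° x0, utility_class k v &
        exists y z : 'rV[R]_2,
          [/\ IDM k u1 u2 x0 = Some y, IDM k v u2 x0 = Some z &
              (u1 y < u1 z)%E]].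
Proof.
pose x0 : 'rV[R]_2 := pt 24 24.
pose y : 'rV[R]_2 := pt 15 15.
pose z : 'rV[R]_2 := pt 20 16.
pose u1 : 'rV[R]_2 -> \bar R := utility 60 1 0 1.
pose u2 : 'rV[R]_2 -> \bar R := utility 60 0 1 1.
pose v : 'rV[R]_2 -> \bar R := utility 60 (8 / 3) (1 / 15) (17 / 15).
have Dx0 : open_dom 60 x0 by split; rewrite !ptE; lra.
have Dy : open_dom 60 y by split; rewrite !ptE; lra.
have Dz : open_dom 60 z by split; rewrite !ptE; lra.
have gu1x0 : gradient u1 x0 = pt (- (1 / 24)) (- (1 / 12)).
  by rewrite gradient_utility// !ptE; congr pt; field.
have gu2x0 : gradient u2 x0 = pt (- (1 / 12)) (- (1 / 24)).
  by rewrite gradient_utility// !ptE; congr pt; field.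
have gvx0 : gradient v x0 = pt (1 / 60) (- (11 / 120)).
  by rewrite gradient_utility// !ptE; congr pt; field.
have gu1y : gradient u1 y = pt (1 / 30) (- (1 / 30)).
  by rewrite gradient_utility// !ptE; congr pt; field.
have gu2y : gradient u2 y = pt (- (1 / 30)) (1 / 30).
  by rewrite gradient_utility// !ptE; congr pt; field.
have gvz : gradient v z = pt (31 / 360) (- (31 / 720)).
  by rewrite gradient_utility// !ptE; congr pt; field.
have gu2z : gradient u2 z = pt (- (1 / 24)) (1 / 48).
  by rewrite gradient_utility// !ptE; congr pt; field.
(* The gradients at [x0] have swapped coordinates and sum to [1 / 8] times (-1, -1); 9 times (-1,
   -1) leads from [x0] to [y]. *)
have IDMu : IDM 60 u1 u2 x0 = Some y.
  apply: IDM_one_step => //;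
    rewrite -/u1 -/u2 ?gu1x0 ?gu2x0 ?gu1y ?gu2y;
    try by apply: pt_neq0; rewrite ?normrN gtr0_norm.
  - have [||||r r0 dE] := bisecting_direction_eq_norm u1 u2 x0
      (pt (-1) (-1)) (1 / 8).
    + lra.
    + by rewrite gu1x0 ptE ?normrN gtr0_norm.
    + by rewrite gu1x0 gu2x0 !euclidean_norm_pt addrC.
    + by rewrite gu1x0 gu2x0 addpt scalept; congr pt; field.
    have yE : y = x0 + 9 *: pt (-1) (-1).
      by rewrite scalept addpt; congr pt; ring.
    rewrite yE; apply: (idm_step_common_maximum _ _ _ _ _ _ _ _ _ r) => //;
      rewrite ?ptE ?normrN ?normr1 ?normr_nat -?yE -/u1 -/u2 ?gu1y ?gu2y
        ?ptE //; lra.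
  - apply: (idm_step_opposed _ _ _ _ 1) => //.
    by rewrite gu1y gu2y scalept; congr pt; ring.
have IDMv : IDM 60 v u2 x0 = Some z.
  apply: IDM_one_step => //;
    rewrite -/v -/u2 ?gvx0 ?gu2x0 ?gvz ?gu2z;
    try by apply: pt_neq0; rewrite ?normrN gtr0_norm.
  (* Both squared norms are 125 / 14400, and the gradients sum to [1 / 15] times (-1, -2); 4 times
     (-1, -2) leads from [x0] to [z]. *)
  - have [||||r r0 dE] := bisecting_direction_eq_norm v u2 x0
      (pt (-1) (-2)) (1 / 15).
    + lra.
    + by rewrite gvx0 ptE ?normrN gtr0_norm.
    + by rewrite gvx0 gu2x0 !euclidean_norm_pt; congr Num.sqrt; field.
    + by rewrite gvx0 gu2x0 addpt scalept; congr pt; field.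
    have zE : z = x0 + 4 *: pt (-1) (-2).
      by rewrite scalept addpt; congr pt; ring.
    rewrite zE; apply: (idm_step_common_maximum _ _ _ _ _ _ _ _ _ r) => //;
      rewrite ?ptE ?normrN ?normr1 ?normr_nat -?zE -/v -/u2 ?gvz ?gu2z
        ?ptE //; lra.
  (* The ratio of the length of the gradient of [u2] at [z] to that of [v]. *)
  - apply: (idm_step_opposed _ _ _ _ (15 / 31)) => //.
    by rewrite gvz gu2z scalept; congr pt; field.
have u1yz : (u1 y < u1 z)%E.
  rewrite /u1 !utility_fin// !ptE lte_fin !mul0r !mul1r !addr0.
  (* The logarithms merge into those of 15 * 30 and 20 * 24. *)
  by rewrite -!lnM ?posrE ?ltr_ln ?posrE; lra.
have vU : utility_class 60 v.
  by exists (8 / 3), (1 / 15), (17 / 15); split => //; lra.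
split=> [SP|].
  have [/(_ IDMv) + _] := SP 60 1 1 x0 v (ler0n _ _) ler01 ler01
    (open_dom_interior _ _ Dx0) vU _ z IDMu.
  by rewrite leNgt u1yz.
exists 60, 1, 1, x0, v; split; first exact: ler0n.
- by rewrite ler01.
- exact: open_dom_interior.
- by [].
- by exists y, z.
Qed.
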